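(* Let $K$ be a number field (viewed inside $\mathbb{C}$), let $n\ge 1$, and let $A=[a_{ij}]\in \mathrm{GL}_n(K)$ with combined matrix $\mathcal{C}(A)=A\circ (A^{-1})^T$. Let $\lambda_1,\ldots,\lambda_n\in\mathbb{C}$ be the eigenvalues of $\mathcal{C}(A)$ counted with multiplicity and let $L=K[\lambda_1,\ldots,\lambda_n]$. Let $A_{ij}$ denote the $(i,j)$ minor of $A$. Then: 1. $\mathcal{C}(A)=[m_{ij}]_{n\times n}$ with $m_{ij}=\dfrac{(-1)^{i+j}}{\det A}\,a_{ij}A_{ij}$. 2. $\mathrm{Tr}(\mathcal{C}(A))=\dfrac{1}{\det A}\displaystyle\sum_{i=1}^n a_{ii}A_{ii}$. 3. $1$ is an eigenvalue of $\mathcal{C}(A)$, with eigenvector $v_1=\displaystyle\sum_{k=1}^n e_k$, where $e_1,\ldots,e_n$ is the canonical basis. 4. $\mathrm{Gal}(L/K)$ is isomorphic to a subgroup of the symmetric group $S_{n-1}$. 5. $\mathcal{C}(\mathcal{R}(A))=\mathcal{R}(\mathcal{C}(A))$, where $\mathcal{R}$ is the reversing operation on $n\times n$ matrices.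
   Context: A number field is a finite extension of $\mathbb{Q}$. $\circ$ denotes the Hadamard (entrywise) product of matrices; the combined matrix of a non-singular matrix $A$ is $\mathcal{C}(A)=A\circ (A^{-1})^T$. The minor $A_{ij}$ is the determinant of the submatrix of $A$ obtained by deleting row $i$ and column $j$. $\mathrm{Gal}(L/K)$ is the group of field automorphisms of $L$ fixing $K$ pointwise. $S_m$ is the symmetric group of order $m!$ ($S_0$ is trivial). Reversing: for an $n\times n$ matrix $M$, $\mathcal{R}(M)=JMJ$, where $J=[\delta_{i,n-j+1}]_{n\times n}$ is the matrix with ones on the antidiagonal and zeros elsewhere (so $J^2=I_n$); i.e. the $(i,j)$ entry of $\mathcal{R}(M)$ is the $(n+1-i,n+1-j)$ entry of $M$. *)

(* Defs.v *)
From HB Require Import structures.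
From mathcomp Require Import all_boot all_order all_algebra all_fingroup.
From mathcomp Require Import fieldext.
From mathcomp Require Import boolp reals complex.
From mathcomp Require Import mpoly.
Set Implicit Arguments.
Unset Strict Implicit.
Unset Printing Implicit Defensive.
Import Order.TTheory GRing.Theory Num.Theory.
Local Open Scope ring_scope.

Section CombinedMatrix.
Variables (F : fieldType) (n : nat).
Implicit Types M : 'M[F]_n.

Definition hadamard M N : 'M[F]_n := map2_mx *%R M N.

Definition combined_mx M : 'M[F]_n := hadamard M (invmx M)^T.

Definition minor (i j : 'I_n) M : F := \det (row' i (col' j M)).

(* [rev_ord j] is [n - 1 - j], the 0-based form of [n + 1 - j]. *)
Definition exchange_mx : 'M[F]_n := \matrix_(i, j) (i == rev_ord j)%:R.

Definition reversing M : 'M[F]_n := exchange_mx *m M *m exchange_mx.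

(* [eigenvalue] of the library is phrased with row vectors; here the matrix
   acts on column vectors. *)
Definition is_eigenvector M (a : F) (v : 'cV[F]_n) : Prop :=
  v != 0 /\ M *m v = a *: v.

End CombinedMatrix.

Section Adjunction.
Variables (K C : fieldType) (iota : {rmorphism K -> C}).
Variables (n : nat) (s : n.-tuple C).

(* K[s_1, ..., s_n] inside C: the values at s of the polynomials over K. *)
Definition adjoin_pred : {pred C} := fun z =>
  `[< exists p : {mpoly K[n]},
        z = (map_mpoly iota p).@[tnth s] >].

Fact adjoin_subring : subring_closed adjoin_pred.
Proof.
split.
- by apply/asboolP; exists 1; rewrite !rmorph1.
- move=> _ _ /asboolP[p ->] /asboolP[q ->]; apply/asboolP; exists (p - q).
  by rewrite !rmorphB.
- move=> _ _ /asboolP[p ->] /asboolP[q ->]; apply/asboolP; exists (p * q).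
  by rewrite !rmorphM.
Qed.

HB.instance Definition _ :=
  GRing.isSubringClosed.Build C adjoin_pred adjoin_subring.

(* When the s_i are algebraic over K this ring is a field, and its ring
   automorphisms are its field automorphisms. *)
Record adjoin := Adjoin { adjoin_val : C; _ : adjoin_val \in adjoin_pred }.

HB.instance Definition _ := [isSub for adjoin_val].
HB.instance Definition _ := [Choice of adjoin by <:].
HB.instance Definition _ := [SubChoice_isSubComNzRing of adjoin by <:].

Definition fixaut_pred : pred (adjoin -> adjoin) := fun g =>
  `[< [/\ bijective g, zmod_morphism g, GRing.monoid_morphism g
        & forall (a : K) (x : adjoin), \val x = iota a -> g x = x] >].

(* Gal(L/K) for L = K[s_1, ..., s_n], with composition as group law. *)
Record fixaut :=
  Fixaut { fixaut_fun :> adjoin -> adjoin; _ : fixaut_pred fixaut_fun }.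

HB.instance Definition _ := [isSub for fixaut_fun].
HB.instance Definition _ := [Choice of fixaut by <:].

Fact fixaut_pred_one : fixaut_pred id.
Proof. by apply/asboolP; split=> //; exists id. Qed.

Fact fixaut_pred_mul (g h : fixaut) : fixaut_pred (g \o h).
Proof.
case: g h => [g /asboolP[gb ga gm gK]] [h /asboolP[hb ha hm hK]] /=.
apply/asboolP; split.
- exact: bij_comp.
- by move=> x y /=; rewrite ha ga.
- by split=> [|x y] /=; rewrite hm gm.
- by move=> a x xa /=; rewrite (hK a) // (gK a).
Qed.

Fact fixaut_inv_subproof (g : fixaut) :
  {h : adjoin -> adjoin | fixaut_pred h & cancel g h /\ cancel h g}.
Proof.
case: g => [g /= /asboolP[gb ga gm gK]].
suff /cid[h [hP gh]] :
    exists h : adjoin -> adjoin, fixaut_pred h /\ (cancel g h /\ cancel h g).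
  by exists h.
case: gb => h gh hg; exists h; split=> //; apply/asboolP; split.
- by exists g.
- by move=> x y; apply: (can_inj gh); rewrite ga !hg.
- by split=> [|x y]; apply: (can_inj gh); rewrite gm !hg.
- by move=> a x xa; apply: (can_inj gh); rewrite hg (gK a).
Qed.

Definition fixaut_one : fixaut := Fixaut fixaut_pred_one.
Definition fixaut_mul (g h : fixaut) : fixaut := Fixaut (fixaut_pred_mul g h).
Definition fixaut_inv (g : fixaut) : fixaut :=
  Fixaut (s2valP (fixaut_inv_subproof g)).

Fact fixaut_mulA : associative fixaut_mul.
Proof. by move=> f g h; apply: val_inj. Qed.

Fact fixaut_mul1 : left_id fixaut_one fixaut_mul.
Proof. by move=> g; apply: val_inj. Qed.

Fact fixaut_1mul : right_id fixaut_one fixaut_mul.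
Proof. by move=> g; apply: val_inj. Qed.

Fact fixaut_mulV : left_inverse fixaut_one fixaut_inv fixaut_mul.
Proof.
move=> g; apply: val_inj; apply: funext => x /=.
exact: (s2valP' (fixaut_inv_subproof g)).1.
Qed.

Fact fixaut_Vmul : right_inverse fixaut_one fixaut_inv fixaut_mul.
Proof.
move=> g; apply: val_inj; apply: funext => x /=.
exact: (s2valP' (fixaut_inv_subproof g)).2.
Qed.

HB.instance Definition _ :=
  isGroup.Build fixaut fixaut_mulA fixaut_mul1 fixaut_1mul
    fixaut_mulV fixaut_Vmul.

End Adjunction.

(* Main.v *)
(* The rows and columns of C(A) sum to 1 because A and its inverse multiply to
   the identity on either side.  For the Galois group: an automorphism over K
   permutes the distinct roots of the characteristic polynomial, is determined
   by this permutation since the roots generate L, and fixes the root 1; at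
   most n - 1 roots remain to be permuted. *)
Require Import Defs.
From HB Require Import structures.
From mathcomp Require Import all_boot all_order all_algebra all_fingroup.
From mathcomp Require Import fieldext.
From mathcomp Require Import boolp reals complex.
From mathcomp Require Import mpoly.
Set Implicit Arguments.
Unset Strict Implicit.
Unset Printing Implicit Defensive.
Import Order.TTheory GRing.Theory Num.Theory.
Local Open Scope ring_scope.

(** * Combined matrices: entries, the eigenvalue 1, reversal *)

Section CombinedMatrixTheory.
Variables (F : fieldType) (n : nat).
Implicit Types M : 'M[F]_n.

Lemma combined_mxE M i j : combined_mx M i j = M i j * invmx M j i.
Proof. by rewrite !mxE. Qed.

Lemma invmxE M i j : M \in unitmx ->
  invmx M i j = (\det M)^-1 * ((-1) ^+ (j + i) * minor j i M).
Proof. by move=> Mu; rewrite /invmx Mu !mxE. Qed.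

(** The transpose in [combined_mx] undoes the one in the adjugate, so each entry of [M] meets its
    own cofactor. *)
Lemma combined_mx_minorE M i j : M \in unitmx ->
  combined_mx M i j = (-1) ^+ (i + j) / \det M * M i j * minor i j M.
Proof.
move=> Mu; rewrite combined_mxE invmxE // mulrC -!mulrA [RHS]mulrCA.
by congr (_ * (_ * _)); rewrite mulrC.
Qed.

Lemma combined_mx_row_sum M i : M \in unitmx -> \sum_j combined_mx M i j = 1.
Proof.
move=> /mulmxV/matrixP/(_ i i); rewrite !mxE eqxx mulr1n => <-.
by apply: eq_bigr => j _; rewrite combined_mxE.
Qed.

Lemma combined_mx_col_sum M j : M \in unitmx -> \sum_i combined_mx M i j = 1.
Proof.
move=> /mulVmx/matrixP/(_ j j); rewrite !mxE eqxx mulr1n => <-.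
by apply: eq_bigr => i _; rewrite combined_mxE mulrC.
Qed.

(** Since [eigenvalue] refers to row vectors, it is the column sums that make the all-ones row an
    eigenvector. In this form 1 becomes a root of the characteristic polynomial. *)
Lemma combined_mx_eigenvalue1 M : (0 < n)%N -> M \in unitmx ->
  eigenvalue (combined_mx M) 1.
Proof.
move=> n_gt0 Mu; apply/eigenvalueP; exists (const_mx 1).
  apply/rowP => j; rewrite scale1r !mxE -[RHS](combined_mx_col_sum j Mu).
  by apply: eq_bigr => i _; rewrite mxE mul1r.
apply/eqP => /rowP/(_ (Ordinal n_gt0))/eqP.
by rewrite !mxE oner_eq0.
Qed.

Lemma sum_delta_col : \sum_(k < n) (delta_mx k 0 : 'cV[F]_n) = const_mx 1.
Proof.
apply/colP => i; rewrite summxE mxE (bigD1 i) //= !mxE !eqxx big1 ?addr0 //.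
by move=> k /negPf ki; rewrite mxE eq_sym ki.
Qed.

Lemma combined_mx_eigenvector1 M : (0 < n)%N -> M \in unitmx ->
  is_eigenvector (combined_mx M) 1 (\sum_(k < n) (delta_mx k 0 : 'cV[F]_n)).
Proof.
move=> n_gt0 Mu; rewrite sum_delta_col; split.
  apply/eqP => /colP/(_ (Ordinal n_gt0))/eqP.
  by rewrite !mxE oner_eq0.
apply/colP => i; rewrite scale1r !mxE -[RHS](combined_mx_row_sum i Mu).
by apply: eq_bigr => j _; rewrite [const_mx _ _ _]mxE mulr1.
Qed.

Lemma reversingE M i j : reversing M i j = M (rev_ord i) (rev_ord j).
Proof.
(* Each product with [exchange_mx] collapses to a single term: at [rev_ord j] here, at [rev_ord i]
   for the inner sum. *)
rewrite !mxE (bigD1 (rev_ord j)) //= !mxE eqxx mulr1 [X in _ + X]big1; last first.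
  by move=> k /negPf kj; rewrite !mxE kj mulr0.
rewrite addr0 (bigD1 (rev_ord i)) //= mxE rev_ordK eqxx mul1r big1 ?addr0 //.
by move=> k ki; rewrite mxE -(inj_eq rev_ord_inj) rev_ordK eq_sym (negPf ki) mul0r.
Qed.

(** Conjugation by an involution is multiplicative; entrywise, this is a reindexing of the sum by
    [rev_ord]. *)
Lemma reversingM M N : reversing M *m reversing N = reversing (M *m N).
Proof.
apply/matrixP => i j; rewrite reversingE !mxE (reindex_inj rev_ord_inj) /=.
by apply: eq_bigr => k _; rewrite !reversingE rev_ordK.
Qed.

Lemma reversing1 : reversing 1%:M = 1%:M :> 'M[F]_n.
Proof. by apply/matrixP => i j; rewrite reversingE !mxE (inj_eq rev_ord_inj). Qed.

Lemma invmx_reversing M : M \in unitmx ->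
  invmx (reversing M) = reversing (invmx M).
Proof.
move=> Mu.
(* For square matrices a one-sided inverse suffices. *)
have MV : reversing M *m reversing (invmx M) = 1%:M.
  by rewrite reversingM mulmxV ?reversing1.
have [rMu _] := mulmx1_unit MV.
by rewrite -[RHS](mulKmx rMu) MV mulmx1.
Qed.

Lemma combined_mx_reversing M : M \in unitmx ->
  combined_mx (reversing M) = reversing (combined_mx M).
Proof.
move=> Mu; apply/matrixP => i j.
by rewrite reversingE !combined_mxE invmx_reversing // !reversingE.
Qed.

End CombinedMatrixTheory.

(** * Faithful actions on a finite set as permutation groups *)

Section FaithfulAction.
Variables (G : groupType) (T : finType) (act : G -> T -> T).
Hypothesis act1 : act 1%g =1 id.
Hypothesis actM : forall g h, act (g * h)%g =1 act g \o act h.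
Hypothesis act_faithful : forall g h, act g =1 act h -> g = h.

Lemma act_inj g : injective (act g).
Proof.
by apply: (can_inj (g := act g^-1%g)) => x; rewrite -[LHS]actM mulVg act1.
Qed.

(* Permutations compose from left to right, [(s * t) x = t (s x)], hence the
   inverse. *)
Definition act_perm g : {perm T} := perm (@act_inj g^-1%g).

Lemma act_permM g h : act_perm (g * h)%g = (act_perm g * act_perm h)%g.
Proof. by apply/permP => x; rewrite permM !permE invgM actM. Qed.

Lemma act_perm_inj : injective act_perm.
Proof.
move=> g h /permP gh; apply: invg_inj; apply: act_faithful => x.
by have := gh x; rewrite !permE.
Qed.

(** [G] carries no finiteness structure, so its image is carved out of the finite type of
    permutations by a classical predicate. *)
Definition act_img : {set {perm T}} := [set p | `[< exists g, act_perm g = p >]].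

Lemma act_perm_img g : act_perm g \in act_img.
Proof. by rewrite inE; apply/asboolP; exists g. Qed.

Fact act_img_group_set : group_set act_img.
Proof.
apply/group_setP; split.
  rewrite inE; apply/asboolP; exists 1%g.
  by apply/permP => x; rewrite permE perm1 invg1 act1.
move=> p q; rewrite !inE => /asboolP[g <-] /asboolP[h <-].
by apply/asboolP; exists (g * h)%g; rewrite act_permM.
Qed.
Canonical act_img_group := Group act_img_group_set.

Definition act_subg g : subg_of act_img_group := subg act_img_group (act_perm g).

Fact act_subg_mul : {morph act_subg : g h / (g * h)%g}.
Proof.
move=> g h; rewrite /act_subg act_permM.
by rewrite [LHS](morphM (subg_morphism _)) ?act_perm_img.
Qed.

HB.instance Definition _ := isMultiplicative.Build _ _ act_subg act_subg_mul.

Lemma act_subg_bij : bijective act_subg.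
Proof.
have subgE g : sgval (act_subg g) = act_perm g by rewrite subgK ?act_perm_img.
(* Surjectivity onto the image; choice turns the preimages into an inverse function. *)
have /choice[inv invP] (u : subg_of act_img_group) : exists g, act_subg g = u.
  have := subgP u; rewrite inE => /asboolP[g gu].
  by exists g; apply: val_inj; rewrite [LHS]subgE.
exists inv => // g; apply: act_perm_inj.
by rewrite -!subgE invP.
Qed.

Lemma faithful_act_embedding :
  exists (H : {group {perm T}}) (f : {multiplicative G -> subg_of H}),
    bijective f.
Proof. by exists act_img_group, act_subg; apply: act_subg_bij. Qed.

End FaithfulAction.

(** * The Galois group acting on the roots of a split polynomial *)

Section RootAction.
Variables (K C : fieldType) (iota : {rmorphism K -> C}).
Variables (n : nat) (s : n.-tuple C).
Local Notation L := (adjoin iota s).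
Local Notation Gal := (fixaut iota s).
Implicit Types (g h : Gal) (x : L).

Fact adjoin_const_in a : iota a \in adjoin_pred iota s.
Proof. by apply/asboolP; exists a%:MP; rewrite map_mpolyC mevalC. Qed.

Fact adjoin_gen_in i : tnth s i \in adjoin_pred iota s.
Proof. by apply/asboolP; exists 'X_i; rewrite map_mpolyX mevalXU. Qed.

Definition adjoin_const a : L := Adjoin (adjoin_const_in a).

Definition adjoin_gen i : L := Adjoin (adjoin_gen_in i).

Fact adjoin_const_zmod : zmod_morphism adjoin_const.
Proof. by move=> a b; apply: val_inj; rewrite /= !rmorphB. Qed.

Fact adjoin_const_monoid : GRing.monoid_morphism adjoin_const.
Proof.
by split=> [|a b]; apply: val_inj; rewrite /= (rmorph1, rmorphM).
Qed.

HB.instance Definition _ :=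
  GRing.isZmodMorphism.Build K L adjoin_const adjoin_const_zmod.
HB.instance Definition _ :=
  GRing.isMonoidMorphism.Build K L adjoin_const adjoin_const_monoid.

Fact fixaut_zmod g : zmod_morphism g.
Proof. by case: g => g /= /asboolP[]. Qed.

Fact fixaut_monoid g : GRing.monoid_morphism g.
Proof. by case: g => g /= /asboolP[]. Qed.

HB.instance Definition _ g :=
  GRing.isZmodMorphism.Build L L (fixaut_fun g) (fixaut_zmod g).
HB.instance Definition _ g :=
  GRing.isMonoidMorphism.Build L L (fixaut_fun g) (fixaut_monoid g).

Lemma fixaut_inj g : injective g.
Proof. by case: g => g /= /asboolP[/bij_inj]. Qed.

Lemma fixaut_const g a : g (adjoin_const a) = adjoin_const a.
Proof. by case: g => g /= /asboolP[_ _ _]; apply. Qed.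

(** The expansion takes place inside [L] rather than in [C], so that automorphisms can be pushed
    through it; [p] supplies the monomials and [c] the coefficients. *)
Lemma adjoinE x : exists p : {mpoly C[n]}, exists c : 'X_{1..n} -> K,
  x = \sum_(m <- msupp p) adjoin_const (c m) * \prod_i adjoin_gen i ^+ m i.
Proof.
have /asboolP[p xp] := valP x.
exists (map_mpoly iota p), (fun m => p@_m); apply: val_inj.
rewrite xp mevalE rmorph_sum; apply: eq_bigr => m _.
rewrite rmorphM rmorph_prod mcoeff_map_mpoly; congr (_ * _).
by apply: eq_bigr => i _; rewrite rmorphXn.
Qed.

Lemma eq_fixaut g h : (forall i, g (adjoin_gen i) = h (adjoin_gen i)) -> g = h.
Proof.
move=> gh; apply: val_inj; apply: funext => x /=.
have [p [c ->]] := adjoinE x; rewrite !rmorph_sum /=; apply: eq_bigr => m _.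
rewrite !rmorphM !rmorph_prod /= !fixaut_const; congr (_ * _).
by apply: eq_bigr => i _; rewrite !rmorphXn /= gh.
Qed.

(** Let [q] be [p] with its coefficients moved into [L]. Then [g] fixes [q], and applying [g] to
    [q.[x] = 0] gives [q.[g x] = 0]. *)
Lemma fixaut_root (p : {poly K}) g x :
  root (map_poly iota p) (val x) -> root (map_poly iota p) (val (g x)).
Proof.
pose q := map_poly adjoin_const p.
have pE : map_poly iota p = map_poly val q.
  by rewrite -map_poly_comp; apply: eq_map_poly.
have gq : map_poly g q = q.
  by rewrite -map_poly_comp; apply: eq_map_poly => a /=; rewrite fixaut_const.
rewrite /root pE -{2}gq !horner_map /= => /eqP qx.
have -> : q.[x] = 0 by apply: val_inj.
by rewrite !rmorph0.
Qed.

Variables (p : {poly K}) (c : K).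
Hypothesis p_split : map_poly iota p = \prod_(z <- s) ('X - z%:P).
Hypothesis c_root : root p c.

(** With duplicates removed, positions in the list correspond one-to-one to the roots other than
    [iota c]. *)
Definition free_roots := undup [seq z <- s | z != iota c].
Local Notation r := free_roots.

Lemma rational_root_mem : iota c \in tval s.
Proof. by rewrite -root_prod_XsubC -p_split fmorph_root. Qed.

(** [iota c] occurs in [s], so the filter drops at least one of the [n] entries. *)
Lemma size_free_roots : (size r <= n.-1)%N.
Proof.
apply: leq_trans (size_undup _) _; rewrite size_filter.
have := count_predC (fun z => z == iota c) s; rewrite size_tuple /= => sn.
have : (0 < count (fun z => z == iota c) s)%N.
  by rewrite -has_count; apply/hasP; exists (iota c) => //; exact: rational_root_mem.
by move=> c_gt0; rewrite -subn1 -[X in (_ <= X - 1)%N]sn addnC -addnBA // leq_addr.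
Qed.

Lemma mem_free_roots z : (z \in r) = (z \in tval s) && (z != iota c).
Proof. by rewrite mem_undup mem_filter andbC. Qed.

(** The default 0 intervenes only outside [L], hence never at an entry of [s]. *)
Definition root_val g z : C := val (g (insubd 0 z)).

Lemma root_insubdK z : z \in tval s -> val (insubd (0 : L) z) = z.
Proof.
by case/tnthP => i ->; rewrite insubdK //; apply: adjoin_gen_in.
Qed.

Lemma root_val_gen g i : root_val g (tnth s i) = val (g (adjoin_gen i)).
Proof.
rewrite /root_val; congr (val (g _)); apply: val_inj.
by rewrite root_insubdK // mem_tnth.
Qed.

(** The image is again a root, and it differs from [iota c] because [g] is injective and already
    fixes [c]. *)
Lemma root_val_mem g z : z \in r -> root_val g z \in r.
Proof.
rewrite !mem_free_roots => /andP[zs zc]; apply/andP; split.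
  rewrite -root_prod_XsubC -p_split; apply: fixaut_root.
  by rewrite root_insubdK // p_split root_prod_XsubC.
apply: contra zc => /eqP zc.
have /fixaut_inj zE : g (insubd 0 z) = g (adjoin_const c).
  by apply: val_inj; rewrite fixaut_const [LHS]zc.
by rewrite -(root_insubdK zs) zE.
Qed.

Lemma root_val1 z : z \in tval s -> root_val 1%g z = z.
Proof. exact: root_insubdK. Qed.

Lemma root_valM g h z : root_val (g * h)%g z = root_val g (root_val h z).
Proof. by rewrite /root_val valKd. Qed.

(* The distinct roots other than [c] are numbered by an initial segment of
   ['I_n.-1]; the indices beyond it, which account for multiplicities, are
   left fixed. *)
Definition root_act g (i : 'I_n.-1) : 'I_n.-1 :=
  if (i < size r)%N then insubd i (index (root_val g r`_i) r) else i.

(** The default of [insubd] is not reached: the index found is below [size r], hence below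
    [n.-1]. *)
Lemma root_actE g (i : 'I_n.-1) : (i < size r)%N ->
  root_act g i = index (root_val g r`_i) r :> nat.
Proof.
move=> ir; rewrite /root_act ir val_insubd.
by rewrite (leq_trans _ size_free_roots) // index_mem root_val_mem // mem_nth.
Qed.

Lemma root_act_nth g (i : 'I_n.-1) : (i < size r)%N ->
  r`_(root_act g i) = root_val g r`_i.
Proof. by move=> ir; rewrite root_actE // nth_index // root_val_mem // mem_nth. Qed.

Lemma root_act1 : root_act 1%g =1 id.
Proof.
move=> i; have [ir|] := boolP (i < size r)%N; last by rewrite /root_act => /negPf->.
apply: val_inj; rewrite /= root_actE // root_val1 ?index_uniq ?undup_uniq //.
by have := mem_nth 0 ir; rewrite mem_free_roots => /andP[].
Qed.

Lemma root_actM g h : root_act (g * h)%g =1 root_act g \o root_act h.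
Proof.
move=> i; have [ir|] := boolP (i < size r)%N; last first.
  by rewrite /root_act /= => /negPf ir; rewrite !ir.
(* The initial segment is stable under the action, so the outer action is also given by
   [root_val]. *)
have hir : (root_act h i < size r)%N.
  by rewrite root_actE // index_mem root_val_mem // mem_nth.
by apply: val_inj; rewrite [RHS]root_actE // root_act_nth // -root_valM -root_actE.
Qed.

(** It suffices to compare generators of [L]: one equal to [iota c] is fixed by both automorphisms,
    and the images of the others can be read off from the action on positions. *)
Lemma root_act_faithful g h : root_act g =1 root_act h -> g = h.
Proof.
move=> gh; apply: eq_fixaut => i.
have [ic|ic] := eqVneq (tnth s i) (iota c).
  have -> : adjoin_gen i = adjoin_const c by apply: val_inj.
  by rewrite !fixaut_const.
have : tnth s i \in r by rewrite mem_free_roots mem_tnth.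
case/(nthP 0) => k kr rk; apply: val_inj; rewrite -!root_val_gen -rk.
have kn := leq_trans kr size_free_roots.
have rE f : root_val f r`_k = r`_(root_act f (Ordinal kn)).
  by rewrite root_act_nth.
by rewrite !rE gh.
Qed.

Lemma fixaut_embedding :
  exists (H : {group 'S_n.-1}) (f : {multiplicative Gal -> subg_of H}),
    bijective f.
Proof.
exact: (faithful_act_embedding root_act1 root_actM root_act_faithful).
Qed.

End RootAction.

Theorem theorem1 (R : realType) (K : fieldExtType rat)
    (iota : {rmorphism K -> R[i]}) (n : nat) (n_gt0 : (0 < n)%N)
    (A : 'M[K]_n) (A_unit : A \in unitmx)
    (lambda : n.-tuple R[i])
    (lambda_eig : char_poly (map_mx iota (combined_mx A)) =
                  \prod_(x <- lambda) ('X - x%:P)) :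
  [/\ combined_mx A =
        \matrix_(i, j) ((-1) ^+ (i + j) / \det A * A i j * minor i j A),
      \tr (combined_mx A) = (\det A)^-1 * \sum_i A i i * minor i i A,
      eigenvalue (combined_mx A) 1 /\
        is_eigenvector (combined_mx A) 1
          (\sum_(k < n) (delta_mx k 0 : 'cV[K]_n)),
      exists (H : {group 'S_n.-1})
             (f : {multiplicative fixaut iota lambda -> subg_of H}),
        bijective f
    & combined_mx (reversing A) = reversing (combined_mx A)].
Proof.
have eig1 := combined_mx_eigenvalue1 n_gt0 A_unit; split.
- by apply/matrixP => i j; rewrite combined_mx_minorE // mxE.
- rewrite mulr_sumr; apply: eq_bigr => i _.
  by rewrite combined_mx_minorE // addnn -mul2n exprM sqrrN !expr1n mul1r mulrA.
- by split; last exact: combined_mx_eigenvector1.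
(* The split polynomial is the characteristic polynomial over [K], and its rational root is the
   eigenvalue 1. *)
- rewrite -map_char_poly in lambda_eig; rewrite eigenvalue_root_char in eig1.
  exact: fixaut_embedding lambda_eig eig1.
- exact: combined_mx_reversing.
Qed.
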